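(* Let $A\in\Gamma$ and let $A^{1/2}:\ell_2\to\ell_2$ be the (positive) square root of $A:\ell_2\to\ell_2$. Then for every $1\le p\le2$, $A^{1/2}$ restricts to a bounded operator $\ell_p\to\ell_1$ with $$\|A^{1/2}\|_{p\to1}\le\|A\|_{1,1}^{1/2}.$$ In particular, $A^{1/2}$ is bounded $\ell_2\to\ell_1$, and by self-adjointness $A^{1/2}$ induces a bounded operator $\ell_\infty\to\ell_2$, so that any $A\in\Gamma$ (acting as an operator $\ell_\infty\to\ell_1$) factors through $\ell_2$.
   Context: Scalars are $\mathbb{R}$ or $\mathbb{C}$; $\ell_p=\ell_p(\mathbb{N})$ with standard basis $(\delta_k)$. $\Gamma$ is the set of bounded self-adjoint operators $A:\ell_2\to\ell_2$ with $\langle Ax,x\rangle\ge0$ for all $x\in\ell_2$ and $\|A\|_{1,1}:=\sum_{k,l}|\langle A\delta_k,\delta_l\rangle|<\infty$. Such an $A$ acts as a bounded operator $\ell_\infty\to\ell_1$ by $b\mapsto\sum_kb(k)A\delta_k$. $\|\cdot\|_{p\to q}$ denotes the operator norm from $\ell_p$ to $\ell_q$. *)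

(* Defs.v *)
From HB Require Import structures.
From mathcomp Require Import all_boot all_order all_algebra.
From mathcomp Require Import complex.
From mathcomp Require Import all_classical all_reals all_analysis.

Set Implicit Arguments.
Unset Strict Implicit.
Unset Printing Implicit Defensive.

Import Order.TTheory GRing.Theory Num.Theory.
Import numFieldNormedType.Exports.

Local Open Scope classical_set_scope.
Local Open Scope ring_scope.

Variant scalar_kind := RealScalars | ComplexScalars.

Definition scalar_field (R : realType) (s : scalar_kind) : numFieldType :=
  match s with RealScalars => R | ComplexScalars => R[i] end.

Definition sconj (R : realType) (s : scalar_kind) :
    scalar_field R s -> scalar_field R s :=
  match s with RealScalars => id | ComplexScalars => @conjc R end.

(* The norm of [scalar_field R s] takes its values in the field itself; [smod] is
   the same modulus with values in R. *)
Definition smod (R : realType) (s : scalar_kind) : scalar_field R s -> R :=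
  match s with
  | RealScalars => fun z : R => `|z|
  | ComplexScalars => @ComplexField.Normc.normc R
  end.

Section SequenceSpaces.
Context {R : realType} {s : scalar_kind}.
Local Notation K := (scalar_field R s).
Implicit Types (p q : \bar R) (x y b : nat -> K).

(* The value is +oo when x is not in ell_p. *)
Definition lp_norm p x : \bar R :=
  Lnorm (counting : {measure set nat -> \bar R}) p (fun k => (smod (x k))%:E).

Definition ell p : set (nat -> K) := [set x | (lp_norm p x < +oo)%E].

Definition delta (k : nat) : nat -> K := fun j => (j == k)%:R.

(* Used both as the inner product of ell_2 and as the sesquilinear pairing of
   ell_oo with ell_1. *)
Definition dot x y : K :=
  limn (fun n : nat => \sum_(0 <= k < n) x k * sconj (y k)).

(* An operator between two sequence spaces is represented by a function on all
   scalar sequences of which only the values on the source space are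
   meaningful; restriction to a smaller space then keeps the same function. *)
Definition operator := (nat -> K) -> (nat -> K).
Implicit Types (A B S T : operator).

Definition linear_on p T := forall (a : K) x y, ell p x -> ell p y ->
  T (fun k => a * x k + y k) = (fun k => a * T x k + T y k).

Definition op_norm p q T : \bar R :=
  ereal_sup [set lp_norm q (T x) | x in [set x | (lp_norm p x <= 1)%E]].

Definition bounded_op p q T :=
  [/\ linear_on p T,
      forall x, ell p x -> ell q (T x)
    & (op_norm p q T < +oo)%E].

Definition self_adjoint T :=
  forall x y, ell 2%:E x -> ell 2%:E y -> dot (T x) y = dot x (T y).

(* For complex scalars, 0 <= z means that z is real and nonnegative. *)
Definition positive_op T := forall x, ell 2%:E x -> 0 <= dot (T x) x.

Definition norm11 A : \bar R :=
  (\esum_(kl in [set: nat * nat])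
     (smod (dot (A (delta kl.1)) (delta kl.2)))%:E)%E.

Definition Gamma : set operator := [set A |
  [/\ bounded_op 2%:E 2%:E A, self_adjoint A, positive_op A
    & (norm11 A < +oo)%E]].

Definition positive_sqrt A B :=
  [/\ bounded_op 2%:E 2%:E B, self_adjoint B, positive_op B
    & forall x, ell 2%:E x -> B (B x) = A x].

(* y is the sum, in the norm of ell_1, of the series of the b(k) A(delta_k):
   the image of b under A acting as an operator from ell_oo to ell_1. *)
Definition action_value A b (y : nat -> K) :=
  ell 1%:E y /\
  lp_norm 1%:E (fun l => (\sum_(0 <= k < n) b k * A (delta k) l) - y l)
    @[n --> \oo] --> 0%E.

(* A = S \o T with T : ell_oo -> ell_2 and S : ell_2 -> ell_1 *)
Definition factorization A S T :=
  [/\ bounded_op +oo%E 2%:E T, bounded_op 2%:E 1%:E S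
    & forall b, ell +oo%E b -> action_value A b (S (T b))].

End SequenceSpaces.

Arguments operator : clear implicits.
Arguments Gamma : clear implicits.

(* Main.v *)
Require Import Defs.
From HB Require Import structures.
From mathcomp Require Import all_boot all_order all_algebra.
From mathcomp Require Import all_classical all_reals all_analysis.
From mathcomp Require Import complex ess_sup_inf.
From mathcomp Require Import ring lra.
Set Implicit Arguments.
Unset Strict Implicit.
Unset Printing Implicit Defensive.
Import Order.TTheory GRing.Theory Num.Theory.
Import numFieldNormedType.Exports.
Local Open Scope classical_set_scope.
Local Open Scope ring_scope.

(* Let c_k be vectors of ell_2 whose Gram matrix is A, say
   <c_k, c_l> = <A delta_k, delta_l>.  For a finitely supported b with
   |b(k)| <= M, expanding the square of the norm of sum_k b(k) c_k gives at most
   M^2 times the sum of the |<A delta_k, delta_l>| with k and l in the support,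
   so these sums converge in ell_2 and define T : ell_oo -> ell_2 of norm at most
   ||A||_{1,1}^(1/2).  Testing y against sum_(k < n) e_k c_k, with e_k the phase
   of <y, c_k>, gives the same bound for S : ell_2 -> ell_1, y |-> (<y, c_k>)_k,
   and S T is the action of A.  A square root B of A yields such vectors
   c_k = B delta_k, for which S = B on ell_2; the bound for p < 2 follows because
   the unit ball of ell_p lies in that of ell_2.  For the bare existence of a
   factorization no square root is needed: the rows of the Cholesky factor of A
   are finitely supported vectors with Gram matrix A. *)

(** * Scalars *)

Section Scalars.
Context {R : realType} {s : scalar_kind}.
Local Notation K := (scalar_field R s).
Implicit Types (z w : K) (r : R).

Fact sconj_is_zmod_morphism : zmod_morphism (@sconj R s).
Proof. by case: s => // x y; rewrite /sconj rmorphB. Qed.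

Fact sconj_is_monoid_morphism : monoid_morphism (@sconj R s).
Proof. by case: s => //; split; [exact: rmorph1 | exact: rmorphM]. Qed.

HB.instance Definition _ :=
  GRing.isZmodMorphism.Build K K (@sconj R s) sconj_is_zmod_morphism.
HB.instance Definition _ :=
  GRing.isMonoidMorphism.Build K K (@sconj R s) sconj_is_monoid_morphism.

(** The norm takes its values in the scalar field itself, which is only partially ordered when
    complex; [emb] moves inequalities between it and R, where the estimates are made for both kinds
    of scalars. *)
Definition emb : R -> K :=
  match s with RealScalars => id | ComplexScalars => real_complex R end.

Fact emb_is_zmod_morphism : zmod_morphism emb.
Proof. by rewrite /emb; case: s => // x y; rewrite rmorphB. Qed.

Fact emb_is_monoid_morphism : monoid_morphism emb.
Proof. by rewrite /emb; case: s => //; split; [exact: rmorph1 | exact: rmorphM]. Qed.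

HB.instance Definition _ :=
  GRing.isZmodMorphism.Build R K emb emb_is_zmod_morphism.
HB.instance Definition _ :=
  GRing.isMonoidMorphism.Build R K emb emb_is_monoid_morphism.

Lemma norm_smod z : `|z| = emb (smod z).
Proof. by rewrite /emb /smod; case: s z => // -[]. Qed.

Lemma ler_emb r1 r2 : (emb r1 <= emb r2) = (r1 <= r2).
Proof. by rewrite /emb; case: s => //; exact: lecR. Qed.

Lemma emb_ge0 r : (0 <= emb r) = (0 <= r).
Proof. by rewrite -ler_emb rmorph0. Qed.

Lemma sconjK z : sconj (sconj z) = z.
Proof. by rewrite /sconj; case: s z => // z; exact: conjcK. Qed.

Lemma sconj_emb r : sconj (emb r) = emb r.
Proof. by rewrite /sconj /emb; case: s => //; exact: conjc_real. Qed.

Lemma mul_sconj z : z * sconj z = emb (smod z ^+ 2).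
Proof.
rewrite rmorphXn/= -norm_smod; rewrite /sconj; case: s z => z.
  by rewrite real_normK ?num_real.
by rewrite sqr_normc.
Qed.

Lemma emb_inj : injective emb.
Proof. by move=> x y xy; apply/eqP; rewrite eq_le -!ler_emb xy lexx. Qed.

Lemma smod_ge0 z : 0 <= smod z.
Proof. by rewrite -ler_emb rmorph0/= -norm_smod. Qed.
#[local] Hint Resolve smod_ge0 : core.

Lemma smodM z w : smod (z * w) = smod z * smod w.
Proof. by apply: emb_inj; rewrite rmorphM/= -!norm_smod normrM. Qed.

Lemma smodD z w : smod (z + w) <= smod z + smod w.
Proof. by rewrite -ler_emb rmorphD/= -!norm_smod ler_normD. Qed.

Lemma smodN z : smod (- z) = smod z.
Proof. by apply: emb_inj; rewrite -!norm_smod normrN. Qed.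

Lemma smodB z w : smod (z - w) = smod (w - z).
Proof. by rewrite -opprB smodN. Qed.

Lemma smod0 : smod (0 : K) = 0.
Proof. by apply: emb_inj; rewrite -!norm_smod normr0 rmorph0. Qed.

Lemma smod_eq0 z : (smod z == 0) = (z == 0).
Proof. by rewrite -(inj_eq emb_inj) -norm_smod rmorph0 normr_eq0. Qed.

Lemma ge0_emb_smod z : 0 <= z -> z = emb (smod z).
Proof. by rewrite -norm_smod => /ger0_norm. Qed.

Lemma smod_emb r : 0 <= r -> smod (emb r) = r.
Proof.
by move=> r0; apply: emb_inj; rewrite -ge0_emb_smod// emb_ge0.
Qed.

Lemma smod1 : smod (1 : K) = 1.
Proof. by rewrite -(rmorph1 emb) smod_emb. Qed.

Lemma ge0_sconj z : 0 <= z -> sconj z = z.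
Proof. by move=> /ge0_emb_smod ->; rewrite sconj_emb. Qed.

Lemma smod_sconj z : smod (sconj z) = smod z.
Proof.
apply: (@pexpIrn _ 2) => //; rewrite ?nnegrE//.
by apply: emb_inj; rewrite -!mul_sconj sconjK mulrC.
Qed.

Lemma smod_sum I (t : seq I) (P : pred I) (F : I -> K) :
  smod (\sum_(i <- t | P i) F i) <= \sum_(i <- t | P i) smod (F i).
Proof.
elim/big_ind2 : _ => //; first by rewrite smod0.
by move=> x1 x2 y1 y2 h1 h2; rewrite (le_trans (smodD _ _))// lerD.
Qed.

Lemma smod_dist z w : `|smod z - smod w| <= smod (z - w).
Proof.
have le_sub (x y : K) : smod x - smod y <= smod (x - y).
  by have := smodD (x - y) y; rewrite subrK lerBlDr.
by rewrite ler_norml le_sub andbT lerNl opprB smodB le_sub.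
Qed.

(** A positive scalar is real even over the complex field, so the radii on the two sides correspond
    through [emb]. *)
Lemma cvg_smodP (u : nat -> K) (l : K) :
  u @ \oo --> l <-> (fun n => smod (l - u n)) @ \oo --> (0 : R).
Proof.
split.
  move=> /cvgrPdist_lt ul; apply/cvgrPdist_lt => e e0.
  have /ul : 0 < emb e by rewrite lt_def fmorph_eq0 gt_eqF//= emb_ge0 ltW.
  apply: filterS => n; rewrite norm_smod sub0r normrN ger0_norm//.
  by rewrite !lt_def ler_emb (inj_eq emb_inj).
move=> /cvgrPdist_lt ul; apply/cvgrPdist_lt => e e0.
have ee := ge0_emb_smod (ltW e0).
have /ul : 0 < smod e by rewrite lt_def smod_ge0 smod_eq0 gt_eqF.
apply: filterS => n; rewrite sub0r normrN ger0_norm// norm_smod [X in _ -> _ < X]ee.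
by rewrite !lt_def ler_emb (inj_eq emb_inj).
Qed.

Lemma cvg_smod (u : nat -> K) (l : K) :
  u @ \oo --> l -> (fun n => smod (u n)) @ \oo --> smod l.
Proof.
move=> /cvg_smodP/cvgrPdist_lt ul; apply/cvgrPdist_lt => e /ul.
apply: filterS => n; rewrite sub0r normrN ger0_norm//.
by apply: le_lt_trans; exact: smod_dist.
Qed.

End Scalars.

#[global] Hint Resolve smod_ge0 : core.

(** * Absolutely convergent scalar series *)

Lemma real_series_cvg (R : realType) (f : nat -> R) (M : R) :
  (forall n, \sum_(0 <= k < n) `|f k| <= M) ->
  cvgn (fun n => \sum_(0 <= k < n) f k).
Proof.
move=> fM; apply: (@normed_cvg R R f).
apply: nondecreasing_is_cvgn; last by exists M => _ [n _ <-]; exact: fM.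
apply/nondecreasing_seqP => n.
by rewrite /= !seriesEnat /= big_nat_recr//= lerDl.
Qed.

(** Real and imaginary parts are dominated by the modulus, so the real case yields the limit of
    each. *)
Lemma series_cvg (R : realType) (s : scalar_kind)
    (f : nat -> scalar_field R s) (M : R) :
  (forall n, \sum_(0 <= k < n) smod (f k) <= M) ->
  cvgn (fun n => \sum_(0 <= k < n) f k).
Proof.
case: s f => f fM; first exact: (real_series_cvg fM).
have Re_cvg : cvgn (fun n => \sum_(0 <= k < n) complex.Re (f k) : R).
  apply: (@real_series_cvg _ _ M) => n; apply: le_trans (fM n).
  apply: ler_sum => k _; rewrite -lecR; exact: normc_ge_Re.
have Im_cvg : cvgn (fun n => \sum_(0 <= k < n) complex.Im (f k) : R).
  apply: (@real_series_cvg _ _ M) => n; apply: le_trans (fM n).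
  apply: ler_sum => k _; rewrite /smod; case: (f k) => a b /=.
  by rewrite -sqrtr_sqr ler_wsqrtr // lerDr sqr_ge0.
apply/cvg_ex; exists (Complex (limn (fun n => \sum_(0 <= k < n) complex.Re (f k)))
  (limn (fun n => \sum_(0 <= k < n) complex.Im (f k)))).
apply/(cvg_smodP (s := ComplexScalars)).
have sumE n : \sum_(0 <= k < n) f k =
    Complex (\sum_(0 <= k < n) complex.Re (f k)) (\sum_(0 <= k < n) complex.Im (f k)).
  elim: n => [|n IH]; first by rewrite !big_nil.
  by rewrite !big_nat_recr//= IH; case: (f n).
(* Taking roots, this bounds the modulus of the complex error by the sum of the errors of the two
   parts. *)
have sqD_le (x y : R) : x ^+ 2 + y ^+ 2 <= (`|x| + `|y|) ^+ 2.
  rewrite sqrrD !real_normK ?num_real// addrAC -addrA lerD2l addrC lerDr.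
  by rewrite mulrn_wge0// mulr_ge0.
set a := limn _ in Re_cvg *; set b := limn _ in Im_cvg *.
apply: (@squeeze_cvgr _ _ _ _ (fun=> 0)
  (fun n => `|a - \sum_(0 <= k < n) complex.Re (f k)| + `|b - \sum_(0 <= k < n) complex.Im (f k)|)).
- apply: nearW => n; rewrite smod_ge0/= sumE /smod/=.
  rewrite -[leRHS]ger0_norm ?addr_ge0// -sqrtr_sqr ler_wsqrtr//.
- exact: cvg_cst.
- rewrite -[X in _ --> X](addr0 0); apply: cvgD.
    by move/cvgrPdist_lt : Re_cvg => h; apply/cvgrPdist_lt => e /h; apply: filterS => n;
      rewrite sub0r normrN normr_id.
  by move/cvgrPdist_lt : Im_cvg => h; apply/cvgrPdist_lt => e /h; apply: filterS => n;
      rewrite sub0r normrN normr_id.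
Qed.

(** * Norms through partial sums *)

Section Norms.
Context {R : realType} {s : scalar_kind}.
Local Notation K := (scalar_field R s).
Implicit Types (x y : nat -> K) (p C : R).

Lemma nneseries_leP (f : nat -> R) C : (forall k, 0 <= f k) ->
  (\sum_(0 <= k <oo) (f k)%:E <= C%:E)%E <->
  (forall n, \sum_(0 <= k < n) f k <= C).
Proof.
move=> f0; split => [fC n|fC].
  rewrite -lee_fin -sumEFin; apply: le_trans fC.
  by apply: nneseries_lim_ge => k _ _; rewrite lee_fin.
apply: lime_le; first by apply: is_cvg_nneseries => k _ _; rewrite lee_fin.
by apply: nearW => n; rewrite sumEFin lee_fin.
Qed.

(** Norm bounds are handled below as bounds on finite partial sums; the p-th root is removed or
    restored by monotonicity of powers on [0, +oo]. *)
Lemma lp_norm_leP p C x : 0 < p -> 0 <= C ->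
  (lp_norm p%:E x <= C%:E)%E <->
  (forall n, \sum_(0 <= k < n) smod (x k) `^ p <= C `^ p).
Proof.
move=> p0 C0; rewrite -nneseries_leP; last by move=> k; exact: powR_ge0.
rewrite /lp_norm Lnorm_counting//.
have -> : (fun n => \sum_(0 <= k < n) `|(smod (x k))%:E| `^ p)%E =
    (fun n => \sum_(0 <= k < n) (smod (x k) `^ p)%:E)%E.
  by apply/funext => n; apply: eq_bigr => k _; rewrite gee0_abs ?lee_fin ?smod_ge0//.
set S := (\sum_(_ <= _ <oo) _)%E.
have S0 : (0 <= S)%E by apply: nneseries_ge0 => k _ _; rewrite lee_fin powR_ge0.
have in0y (z : \bar R) : (0 <= z)%E -> z \in `[0%E, +oo%E].
  by move=> z0; rewrite in_itv/= z0 leey.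
split=> h.
  have := gt0_ler_poweR (ltW p0) (in0y _ (poweR_ge0 _ _)) (in0y C%:E _) h.
  rewrite lee_fin -poweRrM mulVf ?gt_eqF// poweRe1//; exact.
have pV0 : 0 <= p^-1 by rewrite invr_ge0 ltW.
have := gt0_ler_poweR pV0 (in0y _ S0) (in0y (C `^ p)%:E _) h.
rewrite lee_fin powR_ge0 => /(_ isT)/le_trans; apply.
by rewrite -poweR_EFin -poweRrM mulfV ?gt_eqF// poweRe1.
Qed.

Lemma l2_norm_leP C x : 0 <= C -> (lp_norm 2%:E x <= C%:E)%E <->
  (forall n, \sum_(0 <= k < n) smod (x k) ^+ 2 <= C ^+ 2).
Proof.
move=> C0; rewrite lp_norm_leP// -powR_mulrn//.
by split=> h n; have := h n; congr (_ <= _); apply: eq_bigr => k _; rewrite powR_mulrn.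
Qed.

Lemma l1_norm_leP C x : 0 <= C -> (lp_norm 1%:E x <= C%:E)%E <->
  (forall n, \sum_(0 <= k < n) smod (x k) <= C).
Proof.
move=> C0; rewrite lp_norm_leP// powRr1//.
by split=> h n; have := h n; congr (_ <= _); apply: eq_bigr => k _; rewrite powRr1.
Qed.

(** Singletons have counting measure 1, so a null set is empty and an essential bound holds at every
    index. *)
Lemma linfty_norm_leP C x :
  (lp_norm +oo%E x <= C%:E)%E <-> (forall k, smod (x k) <= C).
Proof.
rewrite /lp_norm unlock /=.
(* The norm at +oo is defined by a test on whether the whole space has positive measure. *)
have mu0 : (0 < counting [set: nat] :> \bar R)%E.
  by rewrite /counting asboolF ?ltry//; exact: infinite_nat.
rewrite mu0; split.
  move=> /ess_supP [N [mN N0 sub]] k; apply: contrapT => xk.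
  have Nk : [set k] `<=` N.
    by move=> _ ->; apply: sub => /=; rewrite lee_fin ger0_norm ?smod_ge0.
  have : (counting [set k] <= counting N :> \bar R)%E.
    by apply: le_measure => //; rewrite inE.
  rewrite N0 /counting /= asboolT// fset_set1 finmap.cardfs1.
  by rewrite lee_fin ler10.
move=> h; apply/ess_supP; apply: aeW => k /=.
by rewrite lee_fin ger0_norm ?smod_ge0.
Qed.

Lemma lp_norm_ge0 (q : \bar R) x : (0 <= lp_norm q x)%E.
Proof. exact: Lnorm_ge0. Qed.

Lemma ellP (q : \bar R) x : ell q x <-> exists2 C : R, 0 <= C & (lp_norm q x <= C%:E)%E.
Proof.
split=> [xq|[C _ /le_lt_trans]]; last by apply; rewrite ltry.
exists (fine (lp_norm q x)); first by rewrite fine_ge0// lp_norm_ge0.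
by rewrite fineK// ge0_fin_numE// lp_norm_ge0.
Qed.

Lemma op_norm_le (q r : \bar R) (T : operator R s) (C : \bar R) :
  (forall x, (lp_norm q x <= 1)%E -> (lp_norm r (T x) <= C)%E) ->
  (op_norm q r T <= C)%E.
Proof. by move=> TC; apply: ge_ereal_sup => _ [x /TC h <-]. Qed.

Lemma op_norm_ext (q r : \bar R) (S T : operator R s) :
  (forall x, ell q x -> S x = T x) -> op_norm q r S = op_norm q r T.
Proof.
move=> ST; congr ereal_sup; apply/seteqP; split=> _ [x /= xq <-]; exists x => //;
  by rewrite ST// /ell/= (le_lt_trans xq)// ltry.
Qed.

(** The unordered double sum is an iterated series of nonnegative terms, which is truncated at n in
    each variable in turn. *)
Lemma norm11_ge (A : operator R s) (C : R) (n : nat) : (norm11 A <= C%:E)%E ->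
  \sum_(0 <= k < n) \sum_(0 <= l < n) smod (dot (A (delta k)) (delta l)) <= C.
Proof.
move=> normA; rewrite -lee_fin; apply: le_trans normA.
pose f k l := (smod (dot (A (delta k)) (delta l)))%:E.
have f0 k l : (0 <= f k l)%E by rewrite lee_fin smod_ge0.
have -> : norm11 A = (\esum_(k in setT) \esum_(l in setT) f k l)%E.
  by rewrite esum_esum// /norm11; congr esum; apply/seteqP; split.
rewrite -nneseries_esumT; last by move=> k; apply: esum_ge0 => l _; exact: f0.
apply: (@le_trans _ _ (\sum_(0 <= k < n) \esum_(l in setT) f k l)%E); last first.
  by apply: nneseries_lim_ge => k _ _; apply: esum_ge0 => l _; exact: f0.
rewrite -sumEFin; apply: lee_sum => k _.
rewrite -nneseries_esumT; last by move=> l; exact: f0.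
rewrite -sumEFin.
by apply: nneseries_lim_ge => l _ _; exact: f0.
Qed.

End Norms.

(** * The pairing of ell_2 *)

(** The end of the Cauchy-Schwarz argument, with w in the role of |<x, y>|^2: take t = 1/p if p is
    nonzero; if p = 0, a large t forces w = 0. *)
Lemma discriminant_le (F : numFieldType) (p q w : F) : 0 <= p -> 0 <= q -> 0 <= w ->
  (forall t : F, 0 <= t -> 0 <= t ^+ 2 * w * p - 2 * t * w + q) -> w <= p * q.
Proof.
move=> p0 q0 w0 scale.
have [p_eq0|p_neq0] := eqVneq p 0.
  have [->|w_neq0] := eqVneq w 0; first by rewrite mulr_ge0.
  (* At t = (q + 1) / w the expression equals -(q + 2), which is negative. *)
  have := scale _ (divr_ge0 (addr_ge0 q0 ler01) w0).
  rewrite p_eq0 mulr0 add0r.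
  have -> : - (2 * ((q + 1) / w) * w) + q = - (q + 2) by field.
  by rewrite oppr_ge0 => /(lt_le_trans (ltr_wpDl q0 (ltr0Sn F 1))); rewrite ltxx.
have p_inv : 0 <= p^-1 by rewrite invr_ge0.
have := scale _ p_inv.
have -> : p^-1 ^+ 2 * w * p - 2 * p^-1 * w + q = q - w / p by field.
by rewrite subr_ge0 ler_pdivrMr 1?mulrC// lt_def p_neq0.
Qed.

Section Dot.
Context {R : realType} {s : scalar_kind}.
Local Notation K := (scalar_field R s).
Implicit Types (x y z : nat -> K) (a : K).

Definition lincomb a x y : nat -> K := fun k => a * x k + y k.

Lemma ell2P x :
  ell 2%:E x <-> exists M : R, forall n, \sum_(0 <= k < n) smod (x k) ^+ 2 <= M.
Proof.
split=> [/ellP[C C0 /l2_norm_leP h]|[M xM]]; first by exists (C ^+ 2); exact: h.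
have M0 : 0 <= M by have := xM 0%N; rewrite big_nil.
apply/ellP; exists (Num.sqrt M); first exact: sqrtr_ge0.
by apply/l2_norm_leP; rewrite ?sqrtr_ge0// => n; rewrite sqr_sqrtr.
Qed.

Lemma ell2_lincomb a x y : ell 2%:E x -> ell 2%:E y -> ell 2%:E (lincomb a x y).
Proof.
move=> /ell2P[M xM] /ell2P[N yN]; apply/ell2P.
(* The constants come from (u + v)^2 <= 2 u^2 + 2 v^2. *)
exists (2 * smod a ^+ 2 * M + 2 * N) => n.
apply: (@le_trans _ _ (2 * smod a ^+ 2 * (\sum_(0 <= k < n) smod (x k) ^+ 2) +
                      2 * (\sum_(0 <= k < n) smod (y k) ^+ 2))); last first.
  by rewrite lerD// ler_wpM2l// mulr_ge0// sqr_ge0.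
rewrite !mulr_sumr -big_split/=; apply: ler_sum => k _.
apply: (@le_trans _ _ ((smod a * smod (x k) + smod (y k)) ^+ 2)).
  by rewrite ler_sqr ?nnegrE ?addr_ge0 ?mulr_ge0 ?smod_ge0// -smodM smodD.
have := sqr_ge0 (smod a * smod (x k) - smod (y k)); nra.
Qed.

(** Neither sequence is assumed to be in ell_2, so that this also serves the pairing of ell_oo with
    ell_1. *)
Lemma dot_cvg x y (M : R) :
  (forall n, \sum_(0 <= k < n) smod (x k) * smod (y k) <= M) ->
  (fun n => \sum_(0 <= k < n) x k * sconj (y k)) @ \oo --> dot x y.
Proof.
move=> h; apply: (@series_cvg _ _ (fun k => x k * sconj (y k)) M) => n.
by apply: le_trans (h n); apply: ler_sum => k _; rewrite smodM smod_sconj.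
Qed.

Lemma ell2_dot_cvg x y : ell 2%:E x -> ell 2%:E y ->
  (fun n => \sum_(0 <= k < n) x k * sconj (y k)) @ \oo --> dot x y.
Proof.
move=> /ell2P[M xM] /ell2P[N yN]; apply: (@dot_cvg _ _ (M + N)) => n.
apply: le_trans (lerD (xM n) (yN n)); rewrite -big_split/=.
apply: ler_sum => k _.
have := sqr_ge0 (smod (x k) - smod (y k)).
have := mulr_ge0 (smod_ge0 (x k)) (smod_ge0 (y k)); nra.
Qed.

Lemma dot_finite N x y : (forall k, (N <= k)%N -> x k * sconj (y k) = 0) ->
  dot x y = \sum_(0 <= k < N) x k * sconj (y k).
Proof.
move=> xy0; apply/cvg_lim => //; apply: cvg_near_cst.
exists N => // n /= Nn; rewrite (big_cat_nat (leq0n N) Nn)//= [X in _ + X]big_nat.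
by rewrite [X in _ + X]big1 ?addr0// => k /andP[/xy0].
Qed.

Lemma sum_delta x k n : (k < n)%N -> \sum_(0 <= j < n) x j * delta k j = x k.
Proof.
move=> kn; rewrite big_mkord (bigD1 (Ordinal kn))//= /delta eqxx mulr1.
by rewrite big1 ?addr0// => j jk; rewrite -(inj_eq val_inj)/= in jk; rewrite (negbTE jk) mulr0.
Qed.

Lemma sconj_delta k j : sconj (delta k j : K) = delta k j.
Proof. by rewrite /delta rmorph_nat. Qed.

Lemma dot_delta x k : dot x (delta k) = x k.
Proof.
rewrite (@dot_finite k.+1) => [|j kj].
  by under eq_bigr do rewrite sconj_delta; exact: sum_delta.
by rewrite sconj_delta /delta gtn_eqF// mulr0.
Qed.

Lemma ell2_finite N x : (forall k, (N <= k)%N -> x k = 0) -> ell 2%:E x.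
Proof.
move=> x0; apply/ell2P; exists (\sum_(0 <= k < N) smod (x k) ^+ 2) => n.
have h m : (N <= m)%N -> \sum_(0 <= k < m) smod (x k) ^+ 2 =
    \sum_(0 <= k < N) smod (x k) ^+ 2.
  move=> Nm; rewrite (big_cat_nat (leq0n N) Nm)//= [X in _ + X]big_nat.
  by rewrite [X in _ + X]big1 ?addr0// => k /andP[/x0 -> _]; rewrite smod0 expr0n.
rewrite -(h _ (leq_addl n N)) (big_cat_nat (leq0n n) (leq_addr N n))//= lerDl.
by apply: sumr_ge0 => k _; exact: sqr_ge0.
Qed.

Lemma ell2_delta k : ell 2%:E (delta k : nat -> K).
Proof. by apply: (@ell2_finite k.+1) => j kj; rewrite /delta gtn_eqF. Qed.

Lemma dot_lincomb a x y z : ell 2%:E x -> ell 2%:E y -> ell 2%:E z ->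
  dot (lincomb a x y) z = a * dot x z + dot y z.
Proof.
move=> x2 y2 z2; apply/cvg_lim => //.
rewrite [F in F @ \oo](_ : _ = (fun n => a * (\sum_(0 <= k < n) x k * sconj (z k))
    + \sum_(0 <= k < n) y k * sconj (z k))); last first.
  apply/funext => n; rewrite mulr_sumr -big_split/=.
  by apply: eq_bigr => k _; rewrite /lincomb mulrDl mulrA.
by apply: cvgD; [apply: cvgMr|]; exact: ell2_dot_cvg.
Qed.

Lemma cvg_sconj (u : nat -> K) a :
  u @ \oo --> a -> (fun n => sconj (u n)) @ \oo --> sconj a.
Proof.
move=> /cvg_smodP ua; apply/cvg_smodP.
have -> // : (fun n => smod (sconj a - sconj (u n))) = (fun n => smod (a - u n)).
by apply/funext => n; rewrite -rmorphB/= smod_sconj.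
Qed.

Lemma dotC x y : ell 2%:E x -> ell 2%:E y -> dot y x = sconj (dot x y).
Proof.
move=> x2 y2; apply/cvg_lim => //.
have -> : (fun n => \sum_(0 <= k < n) y k * sconj (x k)) =
    (fun n => sconj (\sum_(0 <= k < n) x k * sconj (y k))).
  apply/funext => n; rewrite rmorph_sum/=; apply: eq_bigr => k _.
  by rewrite rmorphM/= sconjK mulrC.
exact: cvg_sconj (ell2_dot_cvg x2 y2).
Qed.

(** The number r is the supremum of the partial sums of squares; both halves of that property are
    kept, to pass from partial sums to <x, x> and back. *)
Lemma dot_selfP x : ell 2%:E x -> exists r : R,
  [/\ 0 <= r, dot x x = emb r, forall n, \sum_(0 <= k < n) smod (x k) ^+ 2 <= r
    & forall M : R, (forall n, \sum_(0 <= k < n) smod (x k) ^+ 2 <= M) -> r <= M].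
Proof.
move=> x2; have [M xM] := (ell2P x).1 x2.
pose u n := \sum_(0 <= k < n) smod (x k) ^+ 2.
have u_nd : nondecreasing_seq u.
  by apply/nondecreasing_seqP => n; rewrite /u big_nat_recr//= lerDl sqr_ge0.
have u_cvg : cvgn u.
  by apply: nondecreasing_is_cvgn => //; exists M => _ [n _ <-]; exact: xM.
exists (limn u); split.
- by have := nondecreasing_cvgn_le u_nd u_cvg 0%N; rewrite /u big_nil.
- apply/cvg_lim => //; apply/cvg_smodP.
  have /cvgrPdist_lt h := u_cvg; apply/cvgrPdist_lt => e /h.
  apply: filterS => n; rewrite sub0r normrN.
  have -> : \sum_(0 <= k < n) x k * sconj (x k) = emb (u n).
    by rewrite rmorph_sum/=; apply: eq_bigr => k _; rewrite mul_sconj.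
  have un := nondecreasing_cvgn_le u_nd u_cvg n.
  by rewrite -rmorphB/= smod_emb ?subr_ge0// normr_id.
- exact: nondecreasing_cvgn_le.
- by move=> N xN; apply: limr_le => //; apply: nearW.
Qed.

(** Possibly degenerate inner products on ell_2: one notion covers [dot], the form <A x, y> and the
    Schur complements of the latter. *)
Definition psd_form (Q : (nat -> K) -> (nat -> K) -> K) :=
  [/\ forall a x y z, ell 2%:E x -> ell 2%:E y -> ell 2%:E z ->
        Q (lincomb a x y) z = a * Q x z + Q y z,
      forall x y, ell 2%:E x -> ell 2%:E y -> Q y x = sconj (Q x y)
    & forall x, ell 2%:E x -> 0 <= Q x x].

Lemma dot_psd_form : psd_form dot.
Proof.
split; [exact: dot_lincomb|exact: dotC|].
by move=> x /dot_selfP[r [r0 -> _ _]]; rewrite emb_ge0.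
Qed.

Lemma mul_herm_ge0 Q x y : psd_form Q -> ell 2%:E x -> ell 2%:E y ->
  0 <= Q x y * Q y x.
Proof.
by move=> [_ QC _] x2 y2; rewrite (QC x y)// mul_sconj emb_ge0 sqr_ge0.
Qed.

(** The right-hand side is Q(a x + y, a x + y). *)
Lemma psd_form_expand Q a x y : psd_form Q -> ell 2%:E x -> ell 2%:E y ->
  0 <= a * sconj a * Q x x + a * Q x y + sconj a * Q y x + Q y y.
Proof.
move=> [QD QC Q0] x2 y2; have xy2 := ell2_lincomb a x2 y2.
have := Q0 _ xy2; congr (_ <= _).
rewrite QD// (QC (lincomb a x y) x)// (QC (lincomb a x y) y)// !QD//.
rewrite !rmorphD !rmorphM/= -!QC//.
ring.
Qed.

Lemma psd_form_CS Q x y : psd_form Q -> ell 2%:E x -> ell 2%:E y ->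
  Q x y * Q y x <= Q x x * Q y y.
Proof.
move=> Qpsd x2 y2; have [QD QC Q0] := Qpsd.
have w0 := mul_herm_ge0 Qpsd x2 y2.
have scale (t : K) : 0 <= t ->
    0 <= t ^+ 2 * (Q x y * Q y x) * Q x x - 2 * t * (Q x y * Q y x) + Q y y.
  (* With this coefficient both cross terms equal -t |Q(x, y)|^2, which leaves a quadratic in t. *)
  move=> t0; have := psd_form_expand (- t * Q y x) Qpsd x2 y2.
  rewrite rmorphM rmorphN/= (ge0_sconj t0) -(QC y x)//.
  by congr (_ <= _); ring.
exact: discriminant_le (Q0 _ x2) (Q0 _ y2) w0 scale.
Qed.

Lemma dot_le x y (X Y : R) : 0 <= X -> 0 <= Y ->
  (forall n, \sum_(0 <= k < n) smod (x k) ^+ 2 <= X ^+ 2) ->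
  (forall n, \sum_(0 <= k < n) smod (y k) ^+ 2 <= Y ^+ 2) ->
  smod (dot x y) <= X * Y.
Proof.
move=> X0 Y0 xX yY.
have x2 : ell 2%:E x by apply/ell2P; exists (X ^+ 2).
have y2 : ell 2%:E y by apply/ell2P; exists (Y ^+ 2).
have := psd_form_CS dot_psd_form x2 y2.
have [r [r0 -> _ rX]] := dot_selfP x2; have [t [t0 -> _ tY]] := dot_selfP y2.
rewrite (dotC x2 y2) mul_sconj -rmorphM ler_emb => h.
rewrite -ler_sqr ?nnegrE ?mulr_ge0 ?smod_ge0// exprMn (le_trans h)//.
by rewrite ler_pM// ?rX ?tY.
Qed.

End Dot.

(** * Operators attached to a Gram matrix *)

(** The two diagonal blocks are disjoint parts of the large square, and the off-diagonal blocks are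
    nonnegative. *)
Lemma square_sum_split (R : realType) (f : nat -> nat -> R) (m n : nat) :
  (forall k l, 0 <= f k l) -> (m <= n)%N ->
  \sum_(0 <= k < m) \sum_(0 <= l < m) f k l +
  \sum_(m <= k < n) \sum_(m <= l < n) f k l <=
  \sum_(0 <= k < n) \sum_(0 <= l < n) f k l.
Proof.
move=> f0 mn; rewrite [leRHS](big_cat_nat (leq0n m) mn)/=.
have sum0 a b k : 0 <= \sum_(a <= l < b) f k l by apply: sumr_ge0.
apply: lerD; apply: ler_sum => k _; rewrite [leRHS](big_cat_nat (leq0n m) mn)/=.
  by rewrite lerDl.
by rewrite lerDr.
Qed.

(** The sums over the squares [0, n)^2 increase to a limit, and the block over [m, n)^2 is at most
    the increment from m to n. *)
Lemma square_sum_tail (R : realType) (f : nat -> nat -> R) (N e : R) :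
  (forall k l, 0 <= f k l) ->
  (forall n, \sum_(0 <= k < n) \sum_(0 <= l < n) f k l <= N) -> 0 < e ->
  \forall m \near \oo, forall n, \sum_(m <= k < n) \sum_(m <= l < n) f k l <= e.
Proof.
move=> f0 fN e0; pose F n := \sum_(0 <= k < n) \sum_(0 <= l < n) f k l.
have F_nd : nondecreasing_seq F.
  move=> m n mn; apply: le_trans (square_sum_split f0 mn).
  by rewrite lerDl; apply: sumr_ge0 => k _; exact: sumr_ge0.
have F_cvg : cvgn F.
  by apply: nondecreasing_is_cvgn => //; exists N => _ [n _ <-]; exact: fN.
have /cvgrPdist_le/(_ e e0) := F_cvg; apply: filterS => m Fm n.
have [mn|nm] := leqP m n; last by rewrite big_geq ?ltW// ltnW.
have := square_sum_split f0 mn; rewrite -/(F m) -/(F n) -lerBrDl => /le_trans; apply.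
apply: le_trans Fm; apply: le_trans (ler_norm _).
by rewrite lerD2r; exact: nondecreasing_cvgn_le.
Qed.

Section Gram.
Context {R : realType} {s : scalar_kind}.
Local Notation K := (scalar_field R s).
Variables (c : nat -> nat -> K) (N : R).
Hypothesis c2 : forall k, ell 2%:E (c k).
Hypothesis N0 : 0 <= N.
Hypothesis gramN : forall n,
  \sum_(0 <= k < n) \sum_(0 <= l < n) smod (dot (c k) (c l)) <= N.
Implicit Types (b y : nat -> K) (r : seq nat) (M : R).

(** Indexed by a list so that initial segments [0, n) and blocks [m, n) are treated alike. *)
Definition fin_comb b r : nat -> K := fun j => \sum_(k <- r) b k * c k j.

Definition analysis_op : operator R s := fun y k => dot y (c k).

(* The conjugations cancel: the j-th entry is the sum of the b(k) c_k(j). *)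
Definition synthesis_op : operator R s :=
  fun b j => dot b (fun k => sconj (c k j)).

Lemma fin_comb_cons b k r :
  fin_comb b (k :: r) = lincomb (b k) (c k) (fin_comb b r).
Proof. by apply/funext => j; rewrite /fin_comb big_cons. Qed.

Lemma ell2_fin_comb b r : ell 2%:E (fin_comb b r).
Proof.
elim: r => [|k r IH]; last by rewrite fin_comb_cons; exact: ell2_lincomb.
by apply: (@ell2_finite _ _ 0%N) => j _; rewrite /fin_comb big_nil.
Qed.

Lemma dot_fin_comb b r y : ell 2%:E y ->
  dot (fin_comb b r) y = \sum_(k <- r) b k * dot (c k) y.
Proof.
move=> y2; elim: r => [|k r IH].
  rewrite big_nil (@dot_finite _ _ 0%N) ?big_nil// => k _.
  by rewrite /fin_comb big_nil mul0r.
by rewrite fin_comb_cons dot_lincomb// ?IH ?big_cons//; exact: ell2_fin_comb.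
Qed.

(** With v the combination, the left side is at most <v, v>, the sum of the b(k) conj(b(l)) <c_k,
    c_l>. *)
Lemma fin_comb_norm b r M J : 0 <= M -> (forall k, smod (b k) <= M) ->
  \sum_(0 <= j < J) smod (fin_comb b r j) ^+ 2 <=
  M ^+ 2 * \sum_(k <- r) \sum_(l <- r) smod (dot (c k) (c l)).
Proof.
move=> M0 bM; have v2 := ell2_fin_comb b r.
have [t [t0 dott /(_ J)/le_trans h _]] := dot_selfP v2; apply: h.
rewrite -(@smod_emb _ s t)// -dott dot_fin_comb//.
rewrite (le_trans (smod_sum _ _ _))// mulr_sumr; apply: ler_sum => k _.
rewrite (dotC v2)// dot_fin_comb// smodM smod_sconj expr2 -mulrA.
rewrite ler_pM ?smod_ge0// (le_trans (smod_sum _ _ _))// mulr_sumr.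
apply: ler_sum => l _.
by rewrite smodM (dotC (c2 k) (c2 l)) smod_sconj ler_wpM2r ?smod_ge0.
Qed.

(** The witness is z / |z|, or 0 at z = 0. *)
Lemma phase (z : K) : exists2 e : K, smod e <= 1 & sconj e * z = emb (smod z).
Proof.
have [->|z0] := eqVneq z 0.
  by exists 0; rewrite smod0 ?ler01// mulr0 rmorph0.
have sz0 : emb (smod z) != 0 :> K by rewrite fmorph_eq0 smod_eq0.
exists (z / emb (smod z)); last first.
  rewrite rmorphM fmorphV/= sconj_emb mulrAC [sconj z * z]mulrC mul_sconj.
  by rewrite expr2 rmorphM/= mulfK.
rewrite -(ler_pM2r (_ : 0 < smod z)); last by rewrite lt_def smod_eq0 z0 smod_ge0.
by rewrite mul1r -{2}(@smod_emb R s _ (smod_ge0 z)) -smodM divfK.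
Qed.

Lemma analysis_op_norm y (X : R) n : 0 <= X ->
  (forall J, \sum_(0 <= j < J) smod (y j) ^+ 2 <= X ^+ 2) ->
  \sum_(0 <= k < n) smod (analysis_op y k) <= X * Num.sqrt N.
Proof.
move=> X0 yX; have y2 : ell 2%:E y by apply/ell2P; exists (X ^+ 2).
have [e e1 eP] : exists2 e : nat -> K, (forall k, smod (e k) <= 1) &
    forall k, sconj (e k) * analysis_op y k = emb (smod (analysis_op y k)).
  have /choice[e eP] : forall k, exists e : K, smod e <= 1 /\
    sconj e * analysis_op y k = emb (smod (analysis_op y k)).
    by move=> k; have [e e1 eP] := phase (analysis_op y k); exists e.
  by exists e => k; have [] := eP k.
(* The sum to be bounded is <y, v>, and v has norm at most the root of N because |e_k| <= 1. *)
pose v := fin_comb e (index_iota 0 n); have v2 : ell 2%:E v := ell2_fin_comb _ _.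
have dotyv : dot y v = emb (\sum_(0 <= k < n) smod (analysis_op y k)).
  rewrite (dotC v2 y2) dot_fin_comb// !rmorph_sum/=; apply: eq_bigr => k _.
  by rewrite rmorphM/= -(dotC (c2 k) y2) -eP.
have := @dot_le _ _ y v X (Num.sqrt N) X0 (sqrtr_ge0 _) yX.
rewrite dotyv smod_emb ?sumr_ge0// => [|k _]; last exact: smod_ge0.
apply=> J; rewrite sqr_sqrtr//; apply: le_trans (gramN n).
by have := fin_comb_norm (index_iota 0 n) J ler01 e1; rewrite expr1n mul1r.
Qed.

(** This is the previous bound for the unit vector [delta j]; it puts the columns in ell_1, so that
    the series of b(k) c_k converges in each coordinate for bounded b. *)
Lemma column_sum j n : \sum_(0 <= k < n) smod (c k j) <= Num.sqrt N.
Proof.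
have := @analysis_op_norm (delta j) 1 n ler01; rewrite mul1r /analysis_op.
under eq_bigr do rewrite (dotC (c2 _) (ell2_delta _)) dot_delta smod_sconj.
apply=> J; rewrite expr1n; have [jJ|Jj] := ltnP j J.
  (* The squared moduli of [delta j] form the real [delta j], whose sum is known. *)
  rewrite (eq_bigr (fun k => (1 : R) * delta (s := RealScalars) j k)) => [|k _].
    by rewrite (sum_delta (s := RealScalars) (fun=> 1)).
  by rewrite mul1r /delta; case: eqP => _; rewrite ?smod1 ?smod0 ?expr1n ?expr0n.
rewrite big_nat big1// => k /andP[_ kJ].
by rewrite /delta ltn_eqF ?smod0 ?expr0n// (leq_trans kJ).
Qed.

Lemma synthesis_cvg b M j : 0 <= M -> (forall k, smod (b k) <= M) ->
  (fun n => fin_comb b (index_iota 0 n) j) @ \oo --> synthesis_op b j.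
Proof.
move=> M0 bM.
have -> : (fun n => fin_comb b (index_iota 0 n) j) =
    (fun n => \sum_(0 <= k < n) b k * sconj (sconj (c k j))).
  by apply/funext => n; apply: eq_bigr => k _; rewrite sconjK.
apply: (@dot_cvg _ _ _ _ (M * Num.sqrt N)) => n.
apply: le_trans (ler_wpM2l M0 (column_sum j n)); rewrite mulr_sumr.
by apply: ler_sum => k _; rewrite smod_sconj ler_wpM2r ?smod_ge0.
Qed.

(** For n >= m the difference of the finite combinations up to n and m is the one over [m, n),
    bounded by M^2 e; with J fixed, the coordinatewise limit in n preserves this. *)
Lemma synthesis_tail b M (e : R) m J : 0 <= M -> (forall k, smod (b k) <= M) ->
  (forall n, \sum_(m <= k < n) \sum_(m <= l < n) smod (dot (c k) (c l)) <= e) ->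
  \sum_(0 <= j < J) smod (synthesis_op b j - fin_comb b (index_iota 0 m) j) ^+ 2
    <= M ^+ 2 * e.
Proof.
move=> M0 bM me.
pose u n := \sum_(0 <= j < J)
  smod (fin_comb b (index_iota 0 n) j - fin_comb b (index_iota 0 m) j) ^+ 2.
have u_cvg : u @ \oo --> \sum_(0 <= j < J)
    smod (synthesis_op b j - fin_comb b (index_iota 0 m) j) ^+ 2.
  apply: cvg_big => [x|j _]; [exact: add_continuous|rewrite expr2].
  under eq_fun do rewrite expr2.
  have h : (fun n => smod (fin_comb b (index_iota 0 n) j - fin_comb b (index_iota 0 m) j))
      @ \oo --> smod (synthesis_op b j - fin_comb b (index_iota 0 m) j).
    by apply: cvg_smod; apply: cvgB; [exact: synthesis_cvg M0 bM|exact: cvg_cst].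
  exact: cvgM.
rewrite -(cvg_lim _ u_cvg)//; apply: limr_le; first by apply/cvg_ex; eexists; exact: u_cvg.
near=> n; have mn : (m <= n)%N by near: n; exists m.
apply: le_trans (_ : _ <= M ^+ 2 * \sum_(m <= k < n) \sum_(m <= l < n) smod (dot (c k) (c l))) _.
  apply: le_trans (fin_comb_norm (index_iota m n) J M0 bM).
  apply: ler_sum => j _; rewrite /fin_comb.
  by rewrite (big_cat_nat (leq0n m) mn)/= addrAC subrr add0r.
by rewrite ler_wpM2l// sqr_ge0.
Unshelve. all: by end_near. Qed.

Lemma synthesis_norm b M J : 0 <= M -> (forall k, smod (b k) <= M) ->
  \sum_(0 <= j < J) smod (synthesis_op b j) ^+ 2 <= (M * Num.sqrt N) ^+ 2.
Proof.
move=> M0 bM; rewrite exprMn sqr_sqrtr//.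
(* The case m = 0: nothing is subtracted, and the tail is the whole series. *)
have := @synthesis_tail b M N 0 J M0 bM gramN.
by under eq_bigr do rewrite /fin_comb big_nil subr0.
Qed.

Lemma ell2_synthesis b M : 0 <= M -> (forall k, smod (b k) <= M) ->
  ell 2%:E (synthesis_op b).
Proof.
move=> M0 bM; apply/ell2P; exists ((M * Num.sqrt N) ^+ 2) => J.
exact: synthesis_norm.
Qed.

Lemma synthesis_small b M (e : R) : 0 <= M -> (forall k, smod (b k) <= M) -> 0 < e ->
  \forall n \near \oo, forall J, \sum_(0 <= j < J)
    smod (lincomb (-1) (fin_comb b (index_iota 0 n)) (synthesis_op b) j) ^+ 2
    <= e ^+ 2.
Proof.
(* This tail bound becomes M e / (M + 1) <= e; the 1 allows M = 0. *)
move=> M0 bM e0; have eM : 0 < (e / (M + 1)) ^+ 2.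
  by rewrite exprn_gt0// divr_gt0// ltr_wpDl.
have := square_sum_tail (fun k l => smod_ge0 (dot (c k) (c l))) gramN eM.
apply: filterS => n /(synthesis_tail _ M0 bM) h J.
have := h J; under eq_bigr do rewrite addrC -mulN1r.
move=> /le_trans; apply; rewrite -exprMn.
have Me : 0 <= M * (e / (M + 1)) <= e.
  rewrite mulr_ge0 ?divr_ge0 ?addr_ge0 ?(ltW e0)//= mulrCA ger_pMr//.
  by rewrite ler_pdivrMr ?ltr_wpDl// mul1r lerDl ler01.
by case/andP: Me => Me0 Me1; rewrite ler_sqr// ?nnegrE// ltW.
Qed.

(** Adjointness of the two operators: it is exact for finite combinations, and their ell_2
    convergence carries it to the limit by Cauchy-Schwarz. *)
Lemma dot_synthesis b M y : 0 <= M -> (forall k, smod (b k) <= M) ->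
  ell 2%:E y -> dot (synthesis_op b) y = dot b (analysis_op y).
Proof.
move=> M0 bM y2; have [C C0 /l2_norm_leP yC] := (ellP _ _).1 y2.
have Tb2 := ell2_synthesis M0 bM.
apply/esym/cvg_lim => //; apply/cvg_smodP/cvgrPdist_le => e e0.
have eC : 0 < e / (C + 1) by rewrite divr_gt0// ltr_wpDl.
have := synthesis_small M0 bM eC; apply: filterS => n h.
rewrite sub0r normrN ger0_norm ?smod_ge0//.
have -> : \sum_(0 <= k < n) b k * sconj (analysis_op y k) =
    dot (fin_comb b (index_iota 0 n)) y.
  by rewrite dot_fin_comb//; apply: eq_bigr => k _; rewrite -dotC.
rewrite addrC -mulN1r -dot_lincomb//; last exact: ell2_fin_comb.
apply: le_trans (dot_le (ltW eC) C0 h (yC C0)) _.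
by rewrite -mulrA ger_pMr// mulrC ler_pdivrMr ?ltr_wpDl// mul1r lerDl ler01.
Qed.

Lemma analysis_op_bounded : bounded_op 2%:E 1%:E analysis_op /\
  (op_norm 2%:E 1%:E analysis_op <= (Num.sqrt N)%:E)%E.
Proof.
have opN : (op_norm 2%:E 1%:E analysis_op <= (Num.sqrt N)%:E)%E.
  apply: op_norm_le => y /l2_norm_leP-/(_ ler01) y1.
  apply/l1_norm_leP; first exact: sqrtr_ge0.
  by move=> n; rewrite -[leRHS]mul1r; exact: analysis_op_norm ler01 y1.
split=> //; split; last exact: le_lt_trans opN (ltry _).
  by move=> a x y x2 y2; apply/funext => k; exact: dot_lincomb.
move=> y /ellP[C C0 /l2_norm_leP yC]; apply/ellP.
exists (C * Num.sqrt N); first by rewrite mulr_ge0// sqrtr_ge0.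
apply/l1_norm_leP; first by rewrite mulr_ge0// sqrtr_ge0.
by move=> n; apply: analysis_op_norm => //; exact: yC.
Qed.

Lemma synthesis_op_bounded : bounded_op +oo%E 2%:E synthesis_op.
Proof.
split.
- move=> a x y /ellP[C C0 /linfty_norm_leP xC] /ellP[D D0 /linfty_norm_leP yD].
  apply/funext => j.
  have xyE : forall k, smod (lincomb a x y k) <= smod a * C + D.
    move=> k; rewrite (le_trans (smodD _ _))// smodM.
    by apply: lerD (yD k); apply: ler_wpM2l (xC k); exact: smod_ge0.
  have E0 : 0 <= smod a * C + D by rewrite addr_ge0// mulr_ge0// smod_ge0.
  (* As x and y are only bounded, [dot_lincomb] does not apply; linearity comes from that of the
     finite combinations and uniqueness of limits. *)
  have := @synthesis_cvg (lincomb a x y) _ j E0 xyE.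
  have -> : (fun n => fin_comb (lincomb a x y) (index_iota 0 n) j) = (fun n =>
      a * fin_comb x (index_iota 0 n) j + fin_comb y (index_iota 0 n) j).
    apply/funext => n; rewrite /fin_comb mulr_sumr -big_split/=.
    by apply: eq_bigr => k _; rewrite /lincomb mulrDl mulrA.
  move=> /(cvg_lim (@norm_hausdorff _ _)) <-; apply/cvg_lim => //.
  apply: cvgD; last exact: synthesis_cvg D0 yD.
  by apply: cvgMr; exact: synthesis_cvg C0 xC.
- by move=> b /ellP[M M0 /linfty_norm_leP bM]; exact: ell2_synthesis M0 bM.
- apply: (@le_lt_trans _ _ (Num.sqrt N)%:E); last exact: ltry.
  apply: op_norm_le => b /linfty_norm_leP b1; apply/l2_norm_leP; first exact: sqrtr_ge0.
  by move=> J; rewrite -[X in X ^+ 2]mul1r; exact: synthesis_norm ler01 b1.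
Qed.

(** By hypothesis S c_k = A delta_k, so the partial sums of the action of A are the images under S
    of the finite combinations; these converge in ell_2, and S is bounded into ell_1. *)
Lemma gram_factorization (A : operator R s) :
  (forall k l, A (delta k) l = dot (c k) (c l)) ->
  factorization A analysis_op synthesis_op.
Proof.
move=> AE; split; [exact: synthesis_op_bounded|exact: analysis_op_bounded.1|].
move=> b /ellP[M M0 /linfty_norm_leP bM].
have Tb2 := ell2_synthesis M0 bM; split.
  by have [[_ + _] _] := analysis_op_bounded; exact.
set u := (X in X @ _ --> _).
have u0 n : (0 <= u n)%E by exact: lp_norm_ge0.
have small (e : R) : 0 < e -> \forall n \near \oo, (u n <= e%:E)%E.
  move=> e0; have eN : 0 < e / (Num.sqrt N + 1) by rewrite divr_gt0// ltr_wpDl// sqrtr_ge0.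
  have := synthesis_small M0 bM eN; apply: filterS => n h.
  apply/l1_norm_leP; first exact: ltW.
  move=> J; have := analysis_op_norm J (ltW eN) h.
  move=> hJ; rewrite (le_trans _ (le_trans hJ _))//.
    apply: ler_sum => l _; rewrite [X in _ <= smod X]dot_lincomb//; last exact: ell2_fin_comb.
    rewrite dot_fin_comb// mulN1r [X in _ <= smod X]addrC smodB /analysis_op.
    by under eq_bigr do rewrite AE.
  by rewrite -mulrA ger_pMr// mulrC ler_pdivrMr ?ltr_wpDl ?sqrtr_ge0// mul1r lerDl ler01.
apply/fine_cvgP; split.
  by have := small 1 ltr01; apply: filterS => n un; rewrite ge0_fin_numE// (le_lt_trans un)// ltry.
apply/cvgrPdist_le => e /small; apply: filterS => n un.
rewrite sub0r normrN ger0_norm ?fine_ge0// -lee_fin fineK//.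
by rewrite ge0_fin_numE// (le_lt_trans un)// ltry.
Qed.

End Gram.

(** * Cholesky factorization *)

Section Cholesky.
Context {R : realType} {s : scalar_kind}.
Local Notation K := (scalar_field R s).
Implicit Types (Q : (nat -> K) -> (nat -> K) -> K) (x y d : nat -> K).

(** The Schur complement of Q at d; if Q(d, d) = 0, division by 0 makes it Q itself. *)
Definition schur Q d : (nat -> K) -> (nat -> K) -> K :=
  fun x y => Q x y - Q x d * Q d y / Q d d.

(** Positivity of the complement is the Cauchy-Schwarz inequality for Q. *)
Lemma psd_form_schur Q d : psd_form Q -> ell 2%:E d -> psd_form (schur Q d).
Proof.
move=> Qpsd d2; have [QD QC Q0] := Qpsd; split.
- by move=> a x y z x2 y2 z2; rewrite /schur !QD//; ring.
- move=> x y x2 y2; rewrite /schur rmorphB !rmorphM fmorphV/= -!QC//.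
  by rewrite [Q d x * _]mulrC.
move=> x x2; rewrite subr_ge0.
have [->|dd0] := eqVneq (Q d d) 0; first by rewrite invr0 mulr0 Q0.
by rewrite ler_pdivrMr; [exact: psd_form_CS|rewrite lt_def dd0 Q0].
Qed.

(** For a zero pivot, Cauchy-Schwarz gives Q(d, y) = 0 already. *)
Lemma schur_pivot Q d y : psd_form Q -> ell 2%:E d -> ell 2%:E y ->
  schur Q d d y = 0.
Proof.
move=> Qpsd d2 y2; rewrite /schur; have [dd0|dd0] := eqVneq (Q d d) 0; last first.
  by rewrite mulrAC mulfV// mul1r subrr.
have := psd_form_CS Qpsd d2 y2; have [_ QC _] := Qpsd.
rewrite dd0 mul0r (QC d y)// mul_sconj -[X in _ <= X](rmorph0 emb) ler_emb => h.
suff /eqP -> : Q d y == 0 by rewrite mulr0 mul0r subrr.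
by rewrite -smod_eq0 -sqrf_eq0 eq_le h sqr_ge0.
Qed.

Fixpoint schur_iter Q n := match n with
  | 0%N => Q
  | m.+1 => schur (schur_iter Q m) (delta m)
  end.

Lemma psd_form_schur_iter Q n : psd_form Q -> psd_form (schur_iter Q n).
Proof.
by move=> Qpsd; elim: n => //= n IH; apply: psd_form_schur => //; exact: ell2_delta.
Qed.

(** The last pivot has just been eliminated; an earlier one stays in the kernel, since both terms of
    the next complement vanish on it. *)
Lemma schur_iter_eq0 Q n k y : psd_form Q -> (k < n)%N -> ell 2%:E y ->
  schur_iter Q n (delta k) y = 0.
Proof.
move=> Qpsd; elim: n y => // n IH y + y2; rewrite ltnS leq_eqVlt.
case/predU1P => [->|kn]/=.
  by apply: schur_pivot y2; [exact: psd_form_schur_iter|exact: ell2_delta].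
by rewrite /schur !IH ?mul0r ?subr0//; exact: ell2_delta.
Qed.

(* When a pivot vanishes so does its whole column, and division by 0 yields 0. *)
Definition cholesky Q (k n : nat) : K :=
  schur_iter Q n (delta k) (delta n) /
  emb (Num.sqrt (smod (schur_iter Q n (delta n) (delta n)))).

(** The two square roots multiply to the pivot, which leaves the rank-one term subtracted at step n;
    these differences telescope in the next sum. *)
Lemma cholesky_mul Q k l n : psd_form Q ->
  cholesky Q k n * sconj (cholesky Q l n) =
  schur_iter Q n (delta k) (delta l) - schur_iter Q n.+1 (delta k) (delta l).
Proof.
move=> Qpsd; have [_ QC Q0] := psd_form_schur_iter n Qpsd.
have d2 := @ell2_delta R s.
rewrite /= /schur subKr /cholesky rmorphM fmorphV/= sconj_emb -QC//.
rewrite mulrACA -invfM -rmorphM/= -expr2 sqr_sqrtr ?smod_ge0//.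
by rewrite -ge0_emb_smod ?Q0.
Qed.

Lemma cholesky_sum Q k l n : psd_form Q ->
  \sum_(0 <= m < n) cholesky Q k m * sconj (cholesky Q l m) =
  Q (delta k) (delta l) - schur_iter Q n (delta k) (delta l).
Proof.
move=> Qpsd; under eq_bigr do rewrite cholesky_mul//.
elim: n => [|n IH]; first by rewrite big_geq// subrr.
by rewrite big_nat_recr//= IH addrA subrK.
Qed.

Lemma cholesky_eq0 Q k n : psd_form Q -> (k < n)%N -> cholesky Q k n = 0.
Proof.
by move=> Qpsd kn; rewrite /cholesky schur_iter_eq0 ?mul0r//; exact: ell2_delta.
Qed.

Lemma ell2_cholesky Q k : psd_form Q -> ell 2%:E (cholesky Q k).
Proof.
by move=> Qpsd; apply: (@ell2_finite _ _ k.+1) => n; exact: cholesky_eq0.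
Qed.

Lemma dot_cholesky Q k l : psd_form Q ->
  dot (cholesky Q k) (cholesky Q l) = Q (delta k) (delta l).
Proof.
(* Row k ends at index k, and after k + 1 eliminations [delta k] is in the kernel, so no remainder
   is left. *)
move=> Qpsd; rewrite (@dot_finite _ _ k.+1) => [|n /(cholesky_eq0 Qpsd) ->]; last first.
  by rewrite mul0r.
by rewrite cholesky_sum// schur_iter_eq0 ?subr0//; exact: ell2_delta.
Qed.

End Cholesky.

(** * Bounds for ell_p *)

Section Operators.
Context {R : realType} {s : scalar_kind}.
Local Notation K := (scalar_field R s).
Implicit Types (A B S T : operator R s) (x y : nat -> K).

(** Operators are meaningful only on their source space; closure under combinations lets linearity
    be transferred there. *)
Lemma bounded_op_ext (p q : \bar R) S T :
  (forall a x y, ell p x -> ell p y -> ell p (lincomb a x y)) ->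
  (forall x, ell p x -> S x = T x) -> bounded_op p q S -> bounded_op p q T.
Proof.
move=> pD ST [Slin Sell Sfin]; split; last by rewrite -(op_norm_ext q ST).
- by move=> a x y xp yp; have := pD a x y xp yp => xyp; rewrite -!ST//; exact: Slin.
- by move=> x xp; rewrite -ST//; exact: Sell.
Qed.

Lemma smod_le1_of_sum_powR (p : R) x : 0 < p ->
  (forall n, \sum_(0 <= k < n) smod (x k) `^ p <= 1) -> forall k, smod (x k) <= 1.
Proof.
move=> p0 x1 k; have p_neq0 : p != 0 by rewrite gt_eqF.
have -> : smod (x k) = (smod (x k) `^ p) `^ p^-1.
  by rewrite -powRrM mulfV// powRr1// smod_ge0.
have <- : 1 `^ p^-1 = 1 :> R by rewrite powR1.
apply: ge0_ler_powR; rewrite ?nnegrE ?powR_ge0// ?invr_ge0 ?(ltW p0)//.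
apply: le_trans (x1 k.+1); rewrite big_nat_recr//= lerDr.
by apply: sumr_ge0 => j _; exact: powR_ge0.
Qed.

Lemma lp_ball_l2 (p : R) x : 1 <= p <= 2 ->
  (lp_norm p%:E x <= 1)%E -> (lp_norm 2%:E x <= 1)%E.
Proof.
move=> /andP[p1 p2]; have p0 : 0 < p by apply: lt_le_trans p1.
move=> /(lp_norm_leP _ p0 ler01); rewrite powR1 => x1.
apply/(l2_norm_leP _ ler01) => n; rewrite expr1n.
apply: le_trans (x1 n); apply: ler_sum => k _.
have xk1 := smod_le1_of_sum_powR p0 x1 k.
rewrite -powR_mulrn ?smod_ge0//; have [->|xk0] := eqVneq (smod (x k)) 0.
  by rewrite !powR0 ?gt_eqF.
(* Since |x(k)| <= 1 its logarithm is nonpositive, so the larger exponent 2 gives the smaller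
   power. *)
rewrite /powR (negbTE xk0) ler_expR ler_wnM2r//.
by rewrite ln_le0.
Qed.

Lemma ell_sub_ell2 (p : R) x : 1 <= p <= 2 -> ell p%:E x -> ell 2%:E x.
Proof.
move=> p12; have /andP[p1 _] := p12; have p0 : 0 < p by apply: lt_le_trans p1.
move=> /ellP[C C0 /(lp_norm_leP _ p0 C0) xC].
have D0 : 0 < C + 1 by rewrite ltr_wpDl.
(* Scaling by 1 / (C + 1) puts x in the unit ball of ell_p, even when C = 0. *)
pose y := lincomb (emb (C + 1)^-1) x (fun=> 0).
have smody k : smod (y k) = (C + 1)^-1 * smod (x k).
  by rewrite /y /lincomb addr0 smodM smod_emb// invr_ge0 ltW.
have /ellP[E E0 /(l2_norm_leP _ E0) yE] : ell 2%:E y.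
  apply/ellP; exists 1 => //; apply: lp_ball_l2 p12 _.
  apply/(lp_norm_leP _ p0 ler01) => n; rewrite powR1.
  under eq_bigr do rewrite smody powRM ?invr_ge0 ?smod_ge0// ?(ltW D0)//.
  rewrite -mulr_sumr (le_trans (ler_wpM2l (powR_ge0 _ _) (xC n)))//.
  rewrite -powRM ?invr_ge0 ?(ltW D0)//.
  apply: (@le_trans _ _ (1 `^ p)); last by rewrite powR1.
  apply: ge0_ler_powR; rewrite ?nnegrE ?mulr_ge0 ?invr_ge0 ?(ltW D0) ?(ltW p0)//.
  by rewrite mulrC ler_pdivrMr// mul1r lerDl.
apply/ell2P; exists ((C + 1) ^+ 2 * E ^+ 2) => n.
apply: le_trans (ler_wpM2l (sqr_ge0 _) (yE n)); rewrite mulr_sumr.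
apply: ler_sum => k _; rewrite smody exprMn mulrA -exprMn mulfV ?gt_eqF//.
by rewrite expr1n mul1r.
Qed.

Lemma bounded_op_sub_ell2 (p : R) (q : \bar R) T : 1 <= p <= 2 ->
  bounded_op 2%:E q T ->
  bounded_op p%:E q T /\ (op_norm p%:E q T <= op_norm 2%:E q T)%E.
Proof.
move=> p12 [Tlin Tell Tfin].
have le : (op_norm p%:E q T <= op_norm 2%:E q T)%E.
  apply: op_norm_le => x x1; apply: ereal_sup_ubound.
  by exists x => //=; exact: lp_ball_l2 x1.
split=> //; split; last exact: le_lt_trans Tfin.
- by move=> a x y xp yp; apply: Tlin; exact: ell_sub_ell2 p12 _.
- by move=> x xp; apply: Tell; exact: ell_sub_ell2 p12 _.
Qed.

Lemma norm11_fine A : (norm11 A < +oo)%E -> norm11 A = (fine (norm11 A))%:E.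
Proof.
move=> Afin; rewrite fineK// ge0_fin_numE//; apply: esum_ge0 => kl _.
by rewrite lee_fin smod_ge0.
Qed.

Lemma Gamma_dot_psd A : Gamma R s A -> psd_form (fun x y => dot (A x) y).
Proof.
move=> [[Alin Aell _] Asa Apos _]; split=> //.
- by move=> a x y z x2 y2 z2; rewrite /lincomb Alin//; apply: dot_lincomb => //; exact: Aell.
- by move=> x y x2 y2; rewrite -(dotC (Aell _ x2) y2) Asa.
Qed.

End Operators.

(** * The square root of A and the factorization through ell_2 *)

Theorem lemma5p12 (R : realType) (s : scalar_kind) (A : operator R s)
    (hA : Gamma R s A) :
  (forall B : operator R s, positive_sqrt A B ->
    [/\ forall p : R, 1 <= p <= 2 ->
          bounded_op p%:E 1%:E B /\
          (op_norm p%:E 1%:E B <= sqrte (norm11 A))%E,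
        bounded_op 2%:E 1%:E B
      & exists T : operator R s,
          [/\ bounded_op +oo%E 2%:E T,
              forall x, ell 2%:E x -> T x = B x,
              forall b x, ell +oo%E b -> ell 2%:E x ->
                dot (T b) x = dot b (B x)
            & factorization A B T]])
  /\ (exists S T : operator R s, factorization A S T).
Proof.
have [_ _ _ Afin] := hA; have Apsd := Gamma_dot_psd hA.
have NE := norm11_fine Afin; set N := fine (norm11 A) in NE.
have N0 : 0 <= N.
  by have := @norm11_ge _ _ A N 0; rewrite NE big_geq//; apply.
have gram_le (c : nat -> nat -> scalar_field R s) :
    (forall k l, dot (c k) (c l) = dot (A (delta k)) (delta l)) -> forall n,
    \sum_(0 <= k < n) \sum_(0 <= l < n) smod (dot (c k) (c l)) <= N.
  move=> cA n; have := @norm11_ge _ _ A N n; rewrite NE => /(_ (lexx _)).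
  by under eq_bigr do under eq_bigr do rewrite -cA.
split; last first.
  (* The factorization without a square root uses the Cholesky rows as Gram vectors. *)
  pose c := cholesky (fun x y => dot (A x) y).
  have cA k l : dot (c k) (c l) = dot (A (delta k)) (delta l).
    exact: dot_cholesky.
  exists (analysis_op c), (synthesis_op c).
  apply: (@gram_factorization _ _ _ N) => //.
  - by move=> k; exact: ell2_cholesky.
  - exact: gram_le.
  - by move=> k l; rewrite cA dot_delta.
move=> B [[Blin Bell Bfin] Bsa Bpos BB].
have d2 := @ell2_delta R s.
pose c k := B (delta k).
have c2 k : ell 2%:E (c k) by exact: Bell.
(* Moving one B across gives <B delta_k, B delta_l> = <B B delta_k, delta_l>. *)
have cA k l : dot (c k) (c l) = dot (A (delta k)) (delta l).
  by rewrite -(Bsa (c k) (delta l) (c2 k) (d2 l)) /c BB.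
have cN := gram_le c cA.
have BE x : ell 2%:E x -> analysis_op c x = B x.
  move=> x2; apply/funext => k.
  by rewrite /analysis_op -Bsa// dot_delta.
have B21 : bounded_op 2%:E 1%:E B /\ (op_norm 2%:E 1%:E B <= sqrte (norm11 A))%E.
  have [Sb SN] := analysis_op_bounded c2 N0 cN; split.
    by apply: bounded_op_ext Sb => //; exact: ell2_lincomb.
  by rewrite -(op_norm_ext _ BE) NE.
(* Self-adjointness makes the matrix of B Hermitian, so conj(c_k(j)) = c_j(k) and the j-th entry is
   <x, B delta_j> = <B x, delta_j>. *)
have TE x : ell 2%:E x -> synthesis_op c x = B x.
  move=> x2; apply/funext => j; rewrite -(dot_delta (B x)) Bsa//.
  rewrite /synthesis_op; congr dot; apply/funext => k.
  rewrite /c -(dot_delta (B (delta k)) j) Bsa//.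
  by rewrite -(dotC (d2 k) (c2 j)) dot_delta.
split; [|exact: B21.1|].
  move=> p p12; have [Bp Ble] := bounded_op_sub_ell2 p12 B21.1.
  by split=> //; exact: le_trans Ble B21.2.
have fact := @gram_factorization _ _ c N c2 N0 cN A.
have {fact} [Tb Sb act] : factorization A (analysis_op c) (synthesis_op c).
  by apply: fact => k l; rewrite cA dot_delta.
exists (synthesis_op c); split=> //.
  move=> b x /ellP[M M0 /linfty_norm_leP bM] x2.
  by rewrite (dot_synthesis c2 N0 cN M0 bM x2) BE.
split=> //; first exact: B21.1.
(* B agrees with the analysis operator only on ell_2, to which T b belongs. *)
move=> b binfty; rewrite -BE; first exact: act.
by have [_ + _] := Tb; exact.
Qed.
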